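(* For every positive integer $m$, $$T_m(q)=\frac{1}{[m]_q!}\,\langle W_{(m,m)},h_1^{2m}\rangle .$$
   Context: $q$ is a formal variable, $[m]_q!=\prod_{i=1}^m(1+q+\cdots+q^{i-1})$. A chord diagram on $2m$ points is a set partition of $\{1,\ldots,2m\}$ all of whose blocks have size 2 (viewed as chords joining points on a circle in pairs); two chords $\{a,b\}$ and $\{c,d\}$ with $a<b$, $c<d$ cross if $a<c<b<d$ or $c<a<d<b$. $T_m(q)=\sum_{k\ge0}t_{m,k}q^k$, where $t_{m,k}$ is the number of chord diagrams on $2m$ points with exactly $k$ pairs of crossing chords. $W_\mu=W_\mu(\mathbf{x};q)=P_\mu(\mathbf{x};q,0)$ is the $q$-Whittaker symmetric function, the $t=0$ specialization of the Macdonald polynomial $P_\mu(\mathbf{x};q,t)$. Recalled from Macdonald's book (VI.(7.13')): $W_\mu=\sum_{\nu\vdash|\mu|}a_{\mu\nu}(q)m_\nu$, where for $\nu=(\nu_1,\ldots,\nu_k)$, $a_{\mu\nu}(q)=\sum\prod_{j=1}^k\psi_{\mu^j/\mu^{j-1}}(q)$, the sum being over chains of partitions $\emptyset=\mu^0\subseteq\mu^1\subseteq\cdots\subseteq\mu^k=\mu$ with $\mu^j/\mu^{j-1}$ a horizontal strip of size $\nu_j$, and $\psi_{\mu/\rho}(q)=\prod_{i\ge1}{\mu_i-\mu_{i+1}\brack\mu_i-\rho_i}_q$ (with ${n\brack k}_q$ the $q$-binomial coefficient). $h_1$ is the first complete homogeneous symmetric function, and $\langle\cdot,\cdot\rangle$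 is the Hall scalar product on symmetric functions, determined by $\langle m_\lambda,h_\mu\rangle=\delta_{\lambda\mu}$ ($m_\lambda$ monomial, $h_\mu$ complete homogeneous symmetric functions), extended linearly over coefficients in $q$. *)

(* Defs.v *)
From HB Require Import structures.
From mathcomp Require Import all_boot all_order all_algebra.
From mathcomp Require Import fingroup perm.
From mathcomp.multinomials Require Import mpoly.

Set Implicit Arguments.
Unset Strict Implicit.
Unset Printing Implicit Defensive.

Import Order.TTheory GRing.Theory.
Local Open Scope ring_scope.

(* The points 1, ..., n are represented by 0, ..., n.-1, i.e. by 'I_n. *)
Definition chord_diagram (n : nat) (D : {set {set 'I_n}}) : bool :=
  partition D [set: 'I_n] && [forall B in D, #|B| == 2%N].

Definition crossing (n : nat) (B C : {set 'I_n}) : bool :=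
  [exists a : 'I_n, exists b : 'I_n, exists c : 'I_n, exists d : 'I_n,
    [&& B == [set a; b], C == [set c; d], (a < b)%N, (c < d)%N &
        [&& a < c, c < b & b < d]%N || [&& c < a, a < d & d < b]%N]].

Definition crossings (n : nat) (D : {set {set 'I_n}}) : {set {set {set 'I_n}}} :=
  [set [set B; C] | B in D, C in D & crossing B C].

Definition chord_count (m k : nat) : nat :=
  #|[set D : {set {set 'I_(2 * m)}} | chord_diagram D && (#|crossings D| == k)]|.

(* A diagram on 2m points has m chords, so chord_count m k = 0 when
   k > 'C(m, 2). *)
Definition T (m : nat) : {poly rat} :=
  \sum_(k < ('C(m, 2)).+1) (chord_count m k)%:R *: 'X^k.

(* Partitions have no zero parts. The i-th part (i >= 0) of la is nth 0 la i,
   which is 0 beyond the length. *)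
Definition is_part (la : seq nat) : bool := sorted geq la && (0%N \notin la).

Definition partitions (d : nat) : seq (seq nat) :=
  [seq la <- [seq map val b | b : d.-bseq 'I_d.+1]
     | is_part la && (sumn la == d)].

Lemma mem_partitions d la :
  (la \in partitions d) = is_part la && (sumn la == d).
Proof.
rewrite mem_filter /=; case: (boolP (is_part la && _)) => //.
case/andP=> /andP[_ n0] /eqP sl; rewrite [LHS]/=.
have le_nth (s : seq nat) x : x \in s -> (x <= sumn s)%N.
  elim: s => //= y s IH; rewrite inE => /orP[/eqP->|/IH h].
    exact: leq_addr.
  exact: leq_trans h (leq_addl _ _).
have szd : (size [seq inord x : 'I_d.+1 | x <- la] <= d)%N.
  rewrite size_map -sl; elim: la n0 {sl} => //= x s IH.
  rewrite inE negb_or eq_sym -lt0n => /andP[x0 /IH h].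
  by rewrite -add1n leq_add.
apply/mapP; exists (Bseq szd); first by rewrite mem_enum.
rewrite /= -map_comp -[LHS]map_id; apply/eq_in_map => x /le_nth.
by rewrite sl => hx /=; rewrite inordK.
Qed.

Lemma partitions_uniq d : uniq (partitions d).
Proof.
apply/filter_uniq; rewrite map_inj_uniq ?enum_uniq // => b c /(inj_map val_inj) /=.
exact: val_inj.
Qed.

(* The specialization of the last variable to 0. *)
Definition drop_var (R : comNzRingType) (n : nat) (p : {mpoly R[n.+1]}) :
    {mpoly R[n]} :=
  p \mPo [tuple of rcons [tuple 'X_i | i < n] 0].

(* A symmetric function over R is an element of the inverse limit of the rings
   of symmetric polynomials in n variables with respect to drop_var, of bounded
   degree. The field sf_deg is some bound on the degree, not necessarily the
   smallest one; two symmetric functions are the same when they have the same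
   sf_val. *)
Record symfun (R : comNzRingType) := SymFun {
  sf_deg : nat;
  sf_val :> forall n : nat, {mpoly R[n]};
  sf_size : forall n, (msize (sf_val n) <= sf_deg.+1)%N;
  sf_sym : forall n, sf_val n \is symmetric;
  sf_drop : forall n, drop_var (sf_val n.+1) = sf_val n }.

Lemma mcoeff_drop_var (R : comNzRingType) n (p : {mpoly R[n.+1]}) m :
  (drop_var p)@_m = p@_(mnmwiden m).
Proof.
elim/mpolyind: p => [|c k p _ _ IH].
  by rewrite /drop_var comp_mpoly0 !mcoeff0.
rewrite /drop_var comp_mpolyD comp_mpolyZ !mcoeffD !mcoeffZ -/(drop_var p) IH.
congr (c * _ + _); rewrite comp_mpolyX mcoeffX big_ord_recr /=.
rewrite (tnth_nth 0) /= nth_rcons size_map size_enum_ord ltnn eqxx.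
rewrite (eq_bigr (fun i : 'I_n => 'X_i ^+ k (widen_ord (leqnSn n) i))); last first.
  move=> i _; rewrite (tnth_nth 0) /= nth_rcons size_map size_enum_ord ltn_ord.
  by rewrite (nth_map i) ?size_enum_ord // nth_ord_enum.
have [k0|k0] := posnP (k ord_max); last first.
  rewrite expr0n eqn0Ngt k0 mulr0 mcoeff0; case: eqP => // E.
  by move: k0; rewrite E mnmwiden_ordmax.
rewrite k0 expr0 mulr1.
rewrite (_ : \prod_(i < n) _ = 'X_[[multinom k (widen_ord (leqnSn n) i) | i < n]]).
  rewrite mcoeffX; congr (nat_of_bool _)%:R; apply/eqP/eqP => [<-|->].
    apply/mnmP => i; case: (unliftP ord_max i) => [j ->|->].
      have -> : lift ord_max j = widen_ord (leqnSn n) j.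
        by apply: val_inj; rewrite /= /bump leqNgt ltn_ord.
      by rewrite mnmwiden_widen mnmE.
    by rewrite mnmwiden_ordmax.
  by apply/mnmP => i; rewrite mnmE mnmwiden_widen.
by rewrite mpolyXE_id; apply: eq_bigr => i _; rewrite mnmE.
Qed.

Lemma drop_varP (R : comNzRingType) n (p : {mpoly R[n.+1]}) (r : {mpoly R[n]}) :
  (forall m, p@_(mnmwiden m) = r@_m) -> drop_var p = r.
Proof. by move=> h; apply/mpolyP => m; rewrite mcoeff_drop_var h. Qed.

Section Operations.
Context {R : comNzRingType}.
Implicit Types (f g : symfun R).

Fact sf0_size n : (msize (0 : {mpoly R[n]}) <= 1)%N.
Proof. by rewrite msize0. Qed.
Fact sf0_drop n : drop_var (0 : {mpoly R[n.+1]}) = 0.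
Proof. exact: comp_mpoly0. Qed.
Definition sf0 : symfun R :=
  @SymFun R 0 (fun n => 0) sf0_size (fun n => rpred0 _) sf0_drop.

Fact sf1_size n : (msize (1 : {mpoly R[n]}) <= 1)%N.
Proof. by rewrite msize1. Qed.
Fact sf1_drop n : drop_var (1 : {mpoly R[n.+1]}) = 1.
Proof. exact: comp_mpoly1. Qed.
Definition sf1 : symfun R :=
  @SymFun R 0 (fun n => 1) sf1_size (fun n => rpred1 _) sf1_drop.

Fact sf_add_size f g n :
  (msize (f n + g n) <= (maxn (sf_deg f) (sf_deg g)).+1)%N.
Proof.
apply: leq_trans (msizeD_le _ _) _; rewrite -maxnSS geq_max !leq_max.
by rewrite !sf_size orbT.
Qed.
Fact sf_add_sym f g n : f n + g n \is symmetric.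
Proof. by rewrite rpredD ?sf_sym. Qed.
Fact sf_add_drop f g n : drop_var (f n.+1 + g n.+1) = f n + g n.
Proof. by rewrite /drop_var comp_mpolyD; congr (_ + _); apply: sf_drop. Qed.
Definition sf_add f g : symfun R :=
  SymFun (sf_add_size f g) (sf_add_sym f g) (sf_add_drop f g).

Fact sf_scale_size c f n : (msize (c *: f n) <= (sf_deg f).+1)%N.
Proof. exact: leq_trans (msizeZ_le _ _) (sf_size f n). Qed.
Fact sf_scale_sym c f n : c *: f n \is symmetric.
Proof. by rewrite rpredZ ?sf_sym. Qed.
Fact sf_scale_drop c f n : drop_var (c *: f n.+1) = c *: f n.
Proof. by rewrite /drop_var comp_mpolyZ; congr (_ *: _); apply: sf_drop. Qed.
Definition sf_scale c f : symfun R :=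
  SymFun (sf_scale_size c f) (sf_scale_sym c f) (sf_scale_drop c f).

Fact sf_mul_size f g n : (msize (f n * g n) <= (sf_deg f + sf_deg g).+1)%N.
Proof.
rewrite msizeE; apply/bigmax_leqP_seq => m /msuppM_le + _.
case/allpairsP => -[m1 m2] /= [/msize_mdeg_lt h1 /msize_mdeg_lt h2 ->].
rewrite ltnS mdegD leq_add // -ltnS.
  exact: leq_trans h1 (sf_size f n).
exact: leq_trans h2 (sf_size g n).
Qed.
Fact sf_mul_sym f g n : f n * g n \is symmetric.
Proof. by rewrite rpredM ?sf_sym. Qed.
Fact sf_mul_drop f g n : drop_var (f n.+1 * g n.+1) = f n * g n.
Proof. by rewrite /drop_var rmorphM; congr (_ * _); apply: sf_drop. Qed.
Definition sf_mul f g : symfun R :=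
  SymFun (sf_mul_size f g) (sf_mul_sym f g) (sf_mul_drop f g).

Definition sf_exp f (k : nat) : symfun R := iter k (sf_mul f) sf1.

End Operations.

(* The partition obtained by sorting the nonzero exponents of a monomial. *)
Definition part_of_mnm (n : nat) (m : 'X_{1..n}) : seq nat :=
  sort geq [seq i <- (m : n.-tuple nat) | i != 0%N].

(* The sum of the monomials of degree d in n variables whose sorted exponents
   satisfy P. *)
Definition mnm_sum (R : comNzRingType) (d : nat) (P : pred (seq nat)) (n : nat) :
    {mpoly R[n]} :=
  \sum_(m : 'X_{1..n < d.+1} | (mdeg m == d) && P (part_of_mnm m)) 'X_[m].

Lemma mcoeff_mnm_sum (R : comNzRingType) d P n (m : 'X_{1..n}) :
  (mnm_sum R d P n)@_m = ((mdeg m == d) && P (part_of_mnm m))%:R.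
Proof.
rewrite /mnm_sum raddf_sum /=.
under eq_bigr do rewrite mcoeffX.
case: (boolP (_ && _)) => [/andP[/eqP hd hP]|hm].
  have hb : (mdeg m < d.+1)%N by rewrite hd.
  rewrite (bigD1 (BMultinom hb)) /= ?hd ?eqxx ?hP // big1 ?addr0 // => k.
  case/andP=> _ nk; case: eqP => // E.
  by case/eqP: nk; apply: val_inj.
rewrite big1 // => k hk; case: eqP => // E.
by rewrite -E hk in hm.
Qed.

Section MnmSum.
Context {R : comNzRingType} (d : nat) (P : pred (seq nat)).

Fact mnm_sum_size n : (msize (mnm_sum R d P n) <= d.+1)%N.
Proof.
rewrite msizeE; apply/bigmax_leqP_seq => m; rewrite mcoeff_msupp mcoeff_mnm_sum.
by move=> + _; case: (mdeg m =P d) => [->|]; rewrite ?eqxx.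
Qed.
Fact mnm_sum_sym n : mnm_sum R d P n \is symmetric.
Proof.
apply/issymP => s; apply/mpolyP => m.
rewrite mcoeff_sym !mcoeff_mnm_sum mdeg_mperm /part_of_mnm.
suff /(perm_filter (fun i => i != 0%N)) : perm_eq [multinom m (s i) | i < n] m.
  move=> h; congr (_ && P _)%:R; apply/perm_sortP => //.
  - by move=> x y; apply: (leq_total y x).
  - by move=> y x z xy yz; apply: (leq_trans yz xy).
  - by move=> x y; rewrite andbC => /anti_leq.
by apply/tuple_permP; exists s.
Qed.
Fact mnm_sum_drop n : drop_var (mnm_sum R d P n.+1) = mnm_sum R d P n.
Proof.
apply: drop_varP => m; rewrite !mcoeff_mnm_sum.
have -> : mdeg (mnmwiden m) = mdeg m.
  rewrite !mdegE big_ord_recr /= mnmwiden_ordmax addn0.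
  by apply: eq_bigr => i _; rewrite mnmwiden_widen.
by rewrite /part_of_mnm /= -cats1 filter_cat /= cats0.
Qed.
Definition sf_mnm_sum : symfun R :=
  SymFun mnm_sum_size mnm_sum_sym mnm_sum_drop.
End MnmSum.

Section MonomialComplete.
Context {R : comNzRingType}.

Definition sf_m (la : seq nat) : symfun R := sf_mnm_sum (sumn la) (pred1 la).

Definition sf_h (k : nat) : symfun R := sf_mnm_sum k predT.

Definition sf_hprod (la : seq nat) : symfun R := foldr sf_mul sf1 (map sf_h la).

(* The coefficient of m_la in f, i.e. the coefficient of the monomial x^la. By
   sf_drop any number n >= size la of variables gives the same value. *)
Definition coef_m (f : symfun R) (la : seq nat) : R :=
  (f (size la))@_[multinom nth 0%N la i | i < size la].

End MonomialComplete.

Section Hall.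
Context {F : fieldType}.
Implicit Types (f g : symfun F).

Definition nparts (d : nat) : nat := size (partitions d).

(* The coordinates, in the basis (m_la), of the degree d component of f. *)
Definition m_coords (d : nat) f : 'rV[F]_(nparts d) :=
  \row_j coef_m f (nth [::] (partitions d) j).

(* Row i contains the coordinates in (m_la) of the i-th h_mu of degree d. *)
Definition h_to_m (d : nat) : 'M[F]_(nparts d) :=
  \matrix_(i, j) m_coords d (sf_hprod (nth [::] (partitions d) i)) 0 j.

(* The coordinates, in the basis (h_mu), of the degree d component of f. The
   matrix h_to_m d is invertible because the h_mu form a basis of the symmetric
   functions, so that m_coords d f = h_coords d f *m h_to_m d. *)
Definition h_coords (d : nat) f : 'rV[F]_(nparts d) :=
  m_coords d f *m invmx (h_to_m d).

(* The bilinear form with <m_la, h_mu> = 1 if la = mu and 0 otherwise. The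
   components of f of degree > sf_deg f vanish, so the value does not depend on
   the choice of the bound sf_deg f. *)
Definition hall f g : F :=
  \sum_(d < (sf_deg f).+1) \sum_(i < nparts d) m_coords d f 0 i * h_coords d g 0 i.

End Hall.

Definition K : fieldType := {fraction {poly rat}}.

Definition q : K := FracField.tofrac 'X.

Definition qint (n : nat) : K := \sum_(i < n) q ^+ i.

Definition qfact (n : nat) : K := \prod_(1 <= i < n.+1) qint i.

Definition qbinom (n k : nat) : K :=
  if (k <= n)%N then qfact n / (qfact k * qfact (n - k)) else 0.

(* mu/rho is a horizontal strip: rho is contained in mu, and each column j
   contains at most one box (i, j) with rho_i <= j < mu_i. *)
Definition horizontal_strip (mu rho : seq nat) : bool :=
  [forall i : 'I_(maxn (size mu) (size rho)), nth 0%N rho i <= nth 0%N mu i]%N &&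
  [forall j : 'I_(sumn mu),
     #|[set i : 'I_(size mu) | nth 0 rho i <= j < nth 0 mu i]%N| <= 1]%N.

(* The factors with i >= size mu are equal to 1. *)
Definition psi (mu rho : seq nat) : K :=
  \prod_(i < size mu)
    qbinom (nth 0 mu i - nth 0 mu i.+1)%N (nth 0 mu i - nth 0 rho i)%N.

Definition partitions_le (d : nat) : seq (seq nat) :=
  flatten [seq partitions e | e <- iota 0 d.+1].

(* Chains of partitions c_0, ..., c_k from the empty partition to mu in which
   each c_(j+1)/c_j is a horizontal strip of size nu_j (j < k). All members of
   such a chain are partitions of size at most sumn mu. *)
Definition strip_chain (mu nu : seq nat)
    (c : {ffun 'I_(size nu).+1 -> seq_sub (partitions_le (sumn mu))}) : bool :=
  [&& val (c ord0) == [::], val (c ord_max) == mu &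
      [forall j : 'I_(size nu),
         horizontal_strip (val (c (inord j.+1))) (val (c (inord j))) &&
         (sumn (val (c (inord j.+1))) == sumn (val (c (inord j))) + nth 0 nu j)%N]].

Arguments strip_chain : clear implicits.

Definition whittaker_coef (mu nu : seq nat) : K :=
  \sum_(c | strip_chain mu nu c)
    \prod_(j < size nu) psi (val (c (inord j.+1))) (val (c (inord j))).

Definition whittaker (mu : seq nat) : symfun K :=
  \big[sf_add/sf0]_(nu <- partitions (sumn mu))
    sf_scale (whittaker_coef mu nu) (sf_m nu).

(* Main.v *)
(* Since h_1^(2m) = h_(1^(2m)), the scalar product is the coefficient of
   m_(1^(2m)) in W_(m,m), a sum over standard tableaux of shape (m,m). Going
   from (a-1,b) to (a,b) has weight [a-b], and from (a,b-1) to (a,b) weight [b].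
   On the other side, the matchings of the first n points with k points left
   open, counted by q to the number of crossings already determined, have
   generating functions F(n,k) with
     F(n+1,k) = F(n,k-1) + [k+1] F(n,k+1):
   point n+1 is left open, or closes one of k+1 open points and crosses the
   chords of the open points to the right of it. Induction shows that the
   tableaux ending at (a,b) contribute [b]! [a-b]! F(a+b,a-b), which is
   [m]! T_m(q) at a = b = m. *)
Require Import Defs.
From mathcomp Require Import all_boot all_order all_algebra zify.
From mathcomp.multinomials Require Import mpoly.

Set Implicit Arguments.
Unset Strict Implicit.
Unset Printing Implicit Defensive.

Import Order.TTheory GRing.Theory.
Local Open Scope ring_scope.

(** * The complete homogeneous basis and the scalar product *)

Lemma mcoeffXM (R : comNzRingType) n (a m : 'X_{1..n}) (p : {mpoly R[n]}) :
  ('X_[a] * p)@_m = if (a <= m)%MM then p@_(m - a) else 0.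
Proof.
rewrite mulrC; case: ifP => [le_am|nle_am].
  by rewrite -{1}(submK le_am) addmC mcoeffMX.
apply/eqP; rewrite mcoeff_eq0; apply/negP => /msuppM_le.
case/allpairsP => -[m1 m2] /= [_]; rewrite msuppX inE => /eqP -> E.
by rewrite E lem_addl in nle_am.
Qed.

(** Expanding the product of [F i + 1], with [F] equal to -1 on [S] and 0 elsewhere, gives this sum;
    the factor at a point of [S] is zero. *)
Lemma sum_sign_subset (R : comNzRingType) (T : finType) (S : {set T}) :
  S != set0 -> \sum_(A : {set T} | A \subset S) (-1) ^+ #|A| = 0 :> R.
Proof.
case/set0Pn => x xS.
pose F i : R := if i \in S then -1 else 0.
have : \prod_i (F i + 1) = _ := bigA_distr _ _ _ _.
rewrite (bigD1 x) //= /F xS addNr mul0r => /esym E.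
rewrite -[RHS]E big_mkcond; apply: eq_bigr => A _.
case: ifP => [/subsetP AS|/subsetPn[y yA yS]].
  rewrite -big_mkcond /= (eq_bigr (fun=> -1)) => [|i /AS -> //].
  by rewrite prodr_const.
by rewrite (bigD1 y) //= yA (negbTE yS) mul0r.
Qed.

Lemma mesym1_le n (A : {set 'I_n}) (m : 'X_{1..n}) :
  (mesym1 A <= m)%MM = (A \subset [set i | m i != 0%N]).
Proof.
apply/mnm_lepP/subsetP => [h i iA|h i].
  by have := h i; rewrite mnmE iA inE lt0n.
by rewrite mnmE; case: (boolP (i \in A)) => // /h; rewrite inE lt0n.
Qed.

(** The coefficient of a monomial [m] of degree [k] in e_i h_(k-i) counts the [i]-subsets of the
    support of [m]. The signed count over all subsets vanishes, since [0 < k] makes the support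
    nonempty. *)
Lemma mesym_sf_h (R : comNzRingType) (n k : nat) : (0 < k)%N ->
  \sum_(i < k.+1) (-1) ^+ i *: (mesym n R i * (sf_h (k - i) : symfun R) n) = 0.
Proof.
move=> k_gt0; apply/mpolyP => m; rewrite mcoeff0 raddf_sum /=.
pose S := [set i | m i != 0%N].
transitivity (\sum_(i < k.+1) \sum_(A : {set 'I_n} | #|A| == i)
  (if (A \subset S) && (mdeg m == k) then (-1) ^+ #|A| else 0) : R).
  apply: eq_bigr => i _; rewrite mcoeffZ mesymE mulr_suml raddf_sum /= mulr_sumr.
  apply: eq_bigr => A /eqP cA; rewrite mcoeffXM mesym1_le -/S cA.
  case: ifP => AS; rewrite ?mulr0 //= mcoeff_mnm_sum andbT.
  have le_m : (mesym1 A <= m)%MM by rewrite mesym1_le.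
  have -> : (mdeg (m - mesym1 A)%MM == k - i)%N = (mdeg m == k).
    rewrite -[in RHS](submK le_m) mdegD mdeg_mesym1 cA.
    by rewrite -(eqn_add2r i) subnK ?leq_ord.
  by case: eqP => _; rewrite ?mulr1 ?mulr0.
case: (mdeg m =P k) => [Em|_]; last first.
  by rewrite big1 // => i _; rewrite big1 // => A _; rewrite andbF.
have SN0 : S != set0.
  apply: contraTneq k_gt0 => S0; rewrite -Em mdegE big1 // => i _.
  by apply/eqP; have := in_set0 i; rewrite -S0 inE => /negbFE.
rewrite -[RHS](sum_sign_subset R SN0) [RHS]big_mkcond /=.
(* A subset of the support has at most [mdeg m = k] elements, so the range [i < k.+1] reaches every
   subset. *)
have cardA (A : {set _}) : A \subset S -> (#|A| < k.+1)%N.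
  move=> AS; have le_m : (mesym1 A <= m)%MM by rewrite mesym1_le.
  rewrite ltnS -Em -[X in mdeg X](submK le_m) mdegD mdeg_mesym1.
  exact: leq_addl.
under [RHS]eq_bigr => A _.
  rewrite (_ : (if _ then _ else _) = \sum_(i < k.+1 | #|A| == i)
     if A \subset S then (-1) ^+ #|A| else 0); last first.
    case: ifP => AS; last by rewrite big1.
    rewrite (big_pred1 (Ordinal (cardA _ AS))) //.
  over.
rewrite (exchange_big_dep xpredT) //=.
by apply: eq_bigr => i _; apply: eq_bigr => A _; rewrite andbT.
Qed.

Lemma mnm_sum0 (R : comNzRingType) n : mnm_sum R 0 predT n = 1.
Proof.
by apply/mpolyP => m; rewrite mcoeff_mnm_sum mcoeff1 mdeg_eq0 andbT.
Qed.

Lemma sf_hprodE (R : comNzRingType) la n :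
  (sf_hprod la : symfun R) n = \prod_(k <- la) (sf_h k : symfun R) n.
Proof. by elim: la => [|k la IH]; rewrite ?big_nil // big_cons -IH. Qed.

Section HSpan.
Variables (F : fieldType) (n : nat).
Implicit Types p r : {mpoly F[n]}.

(** The number [n] of variables is fixed, so that results on symmetric polynomials apply; [n = d] is
    taken later. *)
Definition hspan (d : nat) p :=
  exists v : seq nat -> F,
    p = \sum_(la <- partitions d) v la *: (sf_hprod la : symfun F) n.

Lemma hspan0 d : hspan d 0.
Proof. by exists (fun=> 0); rewrite big1 // => la _; rewrite scale0r. Qed.

Lemma hspanD d p r : hspan d p -> hspan d r -> hspan d (p + r).
Proof.
case=> [v ->] [w ->]; exists (fun la => v la + w la).
by rewrite -big_split; apply: eq_bigr => la _; rewrite scalerDl.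
Qed.

Lemma hspanZ d c p : hspan d p -> hspan d (c *: p).
Proof.
case=> [v ->]; exists (fun la => c * v la).
by rewrite scaler_sumr; apply: eq_bigr => la _; rewrite scalerA.
Qed.

Lemma hspan_sum d (I : eqType) (s : seq I) (P : pred I) (f : I -> {mpoly F[n]}) :
  (forall i, i \in s -> P i -> hspan d (f i)) -> hspan d (\sum_(i <- s | P i) f i).
Proof.
move=> h; rewrite big_seq_cond; elim/big_ind: _ => [|p r|i /andP[si Pi]].
- exact: hspan0.
- exact: hspanD.
- exact: h.
Qed.

Lemma hspan_gen la : 0%N \notin la -> hspan (sumn la) ((sf_hprod la : symfun F) n).
Proof.
move=> la0; pose mu := sort geq la.
have mu_la : perm_eq mu la by rewrite perm_sort.
have mu_part : mu \in partitions (sumn la).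
  rewrite mem_partitions /is_part sort_sorted; last by move=> x y; exact: leq_total.
  by rewrite (perm_mem mu_la) la0 (perm_sumn mu_la) eqxx.
exists (fun nu => (nu == mu)%:R); rewrite (bigD1_seq mu) ?partitions_uniq //=.
rewrite eqxx scale1r big1 => [|nu /negbTE ->]; last by rewrite scale0r.
by rewrite addr0 !sf_hprodE; apply/perm_big; rewrite perm_sym.
Qed.

Lemma hspanM d e p r : hspan d p -> hspan e r -> hspan (d + e) (p * r).
Proof.
case=> [v ->] [w ->]; rewrite mulr_suml; apply: hspan_sum => la + _.
rewrite mem_partitions => /andP[/andP[_ la0] /eqP <-].
rewrite mulr_sumr; apply: hspan_sum => mu + _.
rewrite mem_partitions => /andP[/andP[_ mu0] /eqP <-].
rewrite -scalerAl -scalerAr; do 2!apply: hspanZ.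
rewrite !sf_hprodE -big_cat -sf_hprodE -sumn_cat.
by apply: hspan_gen; rewrite mem_cat negb_or la0.
Qed.

Lemma hspan1 : hspan 0 1.
Proof. exact: (@hspan_gen [::] isT). Qed.

Lemma hspan_h k : hspan k ((sf_h k : symfun F) n).
Proof.
case: k => [|k]; last first.
  by have := @hspan_gen [:: k.+1] isT; rewrite /= addn0 mulr1.
by rewrite /= mnm_sum0; exact: hspan1.
Qed.

(** Strong induction on [k]: the relation between the e_i and the h_j is solved for e_k, leaving
    products e_i h_(k-i) with [i < k]. *)
Lemma hspan_mesym k : hspan k (mesym n F k).
Proof.
elim/ltn_ind: k => k IH; case: (posnP k) => [->|k_gt0].
  by rewrite mesym0E; exact: hspan1.
have := mesym_sf_h F n k_gt0; rewrite big_ord_recr /= subnn.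
rewrite mnm_sum0 mulr1 addrC => /eqP; rewrite addr_eq0 => /eqP E.
have -> : mesym n F k = (-1) ^+ k *: ((-1) ^+ k *: mesym n F k).
  by rewrite scalerA -exprMn mulrNN mulr1 expr1n scale1r.
rewrite E -scaleN1r; do 2!apply: hspanZ; apply: hspan_sum => i _ _.
apply: hspanZ; rewrite -{1}(subnKC (ltnW (ltn_ord i))).
by apply: hspanM; [exact: IH | exact: hspan_h].
Qed.

Lemma hspan_exp d k p : hspan d p -> hspan (k * d) (p ^+ k).
Proof.
move=> hp; elim: k => [|k IH]; first by rewrite expr0; exact: hspan1.
by rewrite exprS mulSn; exact: hspanM.
Qed.

(** By the fundamental theorem, [p] is a polynomial in the elementary symmetric polynomials,
    homogeneous for the weight giving e_i degree i. Each of its monomials is a product of elements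
    of the spans. *)
Lemma hspan_sym d p : p \is symmetric -> p \is d.-homog -> hspan d p.
Proof.
move=> p_sym p_hom; have [t [<- t_hom]] := sym_fundamental_homog p_sym p_hom.
rewrite comp_mpolyE; apply: hspan_sum => m tm _; apply: hspanZ.
move/dhomogP: t_hom => /(_ m tm) <-; rewrite /mnmwgt /=.
apply: (big_ind2 (fun e r => hspan e r)) => [|e p1 e' p2|i _].
- exact: hspan1.
- exact: hspanM.
- by rewrite tnth_mktuple; apply/hspan_exp/hspan_mesym.
Qed.

End HSpan.

(** * Coefficients of symmetric functions and the scalar product with a power of h_1 *)

Section Coefficients.
Variable R : comNzRingType.
Implicit Types f : symfun R.

Definition mnm_of (n : nat) (la : seq nat) : 'X_{1..n} :=
  [multinom nth 0%N la i | i < n].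

Lemma coef_mE f la n : (size la <= n)%N -> coef_m f la = (f n)@_(mnm_of n la).
Proof.
move=> /subnK <-; elim: (n - size la)%N => [|k IH] //.
rewrite IH addSn -sf_drop mcoeff_drop_var; congr (_@_ _).
apply/mnmP => i; rewrite mnmE; case: (unliftP ord_max i) => [j ->|->].
  have -> : lift ord_max j = widen_ord (leqnSn _) j.
    by apply: val_inj; rewrite /= /bump leqNgt ltn_ord.
  by rewrite mnmwiden_widen mnmE.
by rewrite mnmwiden_ordmax nth_default //= leq_addl.
Qed.

Lemma part_of_mnm_of la : is_part la -> part_of_mnm (mnm_of (size la) la) = la.
Proof.
case/andP=> la_sorted la0; rewrite /part_of_mnm.
have -> : mnm_of (size la) la = la :> seq nat.
  apply: (@eq_from_nth _ 0%N) => [|i]; rewrite ?size_tuple // => lt_i.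
  by rewrite -[i]/(val (Ordinal lt_i)) -tnth_nth -[tnth _ _]/(fun_of_multinom _ _) mnmE.
rewrite (all_filterP _); last by apply/allP => x; apply: contraTneq => ->.
by apply: sorted_sort => // x y z yx xz; exact: leq_trans xz yx.
Qed.

Lemma mdeg_mnm_of la : mdeg (mnm_of (size la) la) = sumn la.
Proof.
by rewrite mdegE sumnE (big_nth 0%N) big_mkord; apply: eq_bigr => i _; rewrite mnmE.
Qed.

Lemma coef_m_sf_m la mu : is_part mu -> coef_m (sf_m la : symfun R) mu = (mu == la)%:R.
Proof.
move=> mu_part; rewrite /coef_m mcoeff_mnm_sum -/(mnm_of _ mu) mdeg_mnm_of.
rewrite part_of_mnm_of //=; have [->|_] := eqVneq mu la; first by rewrite eqxx.
by rewrite andbF.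
Qed.

End Coefficients.

(** This is why [d] variables suffice to read every coefficient in degree [d]. *)
Lemma size_part la : is_part la -> (size la <= sumn la)%N.
Proof.
case/andP=> _; elim: la => //= x la IH; rewrite inE negb_or eq_sym -lt0n.
by case/andP=> x0 /IH; rewrite -add1n; exact: leq_add.
Qed.

Lemma mnm_sum_homog (R : comNzRingType) d P n : mnm_sum R d P n \is d.-homog.
Proof.
apply/dhomogP => m; rewrite mcoeff_msupp mcoeff_mnm_sum.
by apply: contra_neq_eq => /negbTE ->.
Qed.

Lemma part_nth d (i : 'I_(nparts d)) :
  is_part (nth [::] (partitions d) i) /\ sumn (nth [::] (partitions d) i) = d.
Proof.
have := mem_nth [::] (ltn_ord i : i < size (partitions d))%N.
by rewrite mem_partitions => /andP[? /eqP].
Qed.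

(* Writing each m_la as a combination of the h_mu yields a left inverse. *)
Lemma h_to_m_unit (F : fieldType) d : h_to_m d \in (@unitmx F (nparts d)).
Proof.
pose pt (i : 'I_(nparts d)) := nth [::] (partitions d) i.
have ptP i : is_part (pt i) /\ sumn (pt i) = d := part_nth i.
have span i : exists v : seq nat -> F, (sf_m (pt i) : symfun F) d =
    \sum_(la <- partitions d) v la *: (sf_hprod la : symfun F) d.
  apply: hspan_sym; first exact: sf_sym.
  by rewrite /= (ptP i).2; exact: mnm_sum_homog.
have /fin_all_exists[v vE] := span.
suff: (\matrix_(i, j) v i (pt j)) *m h_to_m d = 1%:M by case/mulmx1_unit.
apply/matrixP => i j; rewrite !mxE.
have [j_part jd] := ptP j.
have size_j : (size (pt j) <= d)%N by rewrite -jd size_part.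
transitivity (coef_m (sf_m (pt i) : symfun F) (pt j)); last first.
  rewrite coef_m_sf_m // nth_uniq ?partitions_uniq //.
  by rewrite val_eqE eq_sym.
rewrite (coef_mE _ size_j) vE raddf_sum /= (big_nth [::]) big_mkord.
apply: eq_bigr => k _; rewrite !mxE (coef_mE _ size_j) mcoeffZ.
by rewrite /pt.
Qed.

Lemma sf_exp_hprod (R : comNzRingType) d :
  sf_exp (sf_h 1) d = sf_hprod (nseq d 1%N) :> symfun R.
Proof. by elim: d => // d IH; rewrite /sf_exp iterS -/(sf_exp _ d) IH. Qed.

Lemma coef_m_whittaker mu la : is_part la ->
  coef_m (whittaker mu) la =
  (sumn la == sumn mu)%:R * whittaker_coef mu la.
Proof.
move=> la_part; rewrite /whittaker.
transitivity (\sum_(nu <- partitions (sumn mu))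
  whittaker_coef mu nu * coef_m (sf_m nu : symfun K) la).
  elim: (partitions _) => [|nu s IH]; first by rewrite !big_nil /coef_m mcoeff0.
  rewrite !big_cons -IH /coef_m -mcoeffZ -mcoeffD.
  by [].
under eq_bigr do rewrite coef_m_sf_m //.
have [la_mu|la_mu] := boolP (sumn la == sumn mu); last first.
  rewrite mul0r big_seq big1 // => nu; rewrite mem_partitions => /andP[_ nu_mu].
  case: eqP => [E|_]; last by rewrite mulr0.
  by rewrite -E (negbTE la_mu) in nu_mu.
rewrite (bigD1_seq la) ?partitions_uniq ?mem_partitions ?la_part //= eqxx.
rewrite big1 => [|nu /negbTE nu_la]; first by rewrite mulr1 mul1r addr0.
by rewrite eq_sym nu_la mulr0.
Qed.

(** [hall] sums over the degrees up to the recorded bound [sf_deg], so this bound has to be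
    computed. It is a maximum of copies of [sumn mu], over a list that contains [mu]. *)
Lemma sf_deg_whittaker mu : is_part mu -> sf_deg (whittaker mu) = sumn mu.
Proof.
move=> mu_part; rewrite /whittaker.
have: mu \in partitions (sumn mu) by rewrite mem_partitions mu_part eqxx.
have: all (fun nu => sumn nu == sumn mu) (partitions (sumn mu)).
  by apply/allP => nu; rewrite mem_partitions => /andP[].
move: (partitions _) => s s_all mu_s.
suff: sf_deg (\big[sf_add/sf0]_(nu <- s) sf_scale (whittaker_coef mu nu) (sf_m nu))
    = if s is [::] then 0%N else sumn mu.
  by case: s {s_all} mu_s.
elim: s s_all {mu_s} => [|nu s IH] /=; first by rewrite big_nil.
case/andP=> /eqP nu_mu /IH {}IH; rewrite big_cons /= IH nu_mu.
by case: s {IH} => *; rewrite ?maxn0 ?maxnn.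
Qed.

(** Only the degree of [mu] contributes. There h_1^d is itself a member of the complete homogeneous
    basis, so the pairing extracts the coefficient of the monomial function indexed by 1^d. *)
Lemma hall_whittaker_h1 mu : is_part mu ->
  hall (whittaker mu) (sf_exp (sf_h 1) (sumn mu)) =
  whittaker_coef mu (nseq (sumn mu) 1%N).
Proof.
move=> mu_part; rewrite /hall sf_deg_whittaker // big_ord_recr /=.
rewrite big1 ?add0r => [|d _]; last first.
  apply: big1 => i _; have [i_part di] := part_nth i.
  rewrite mxE coef_m_whittaker // di.
  by rewrite (ltn_eqF (ltn_ord d)) !mul0r.
set d := sumn mu; have ones_part : is_part (nseq d 1%N).
  rewrite /is_part mem_nseq andbF andbT.
  by elim: d => // -[|d] //= ->.
have ones_d : sumn (nseq d 1%N) = d by rewrite sumn_nseq mul1n.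
have ones_mem : nseq d 1%N \in partitions d.
  by rewrite mem_partitions ones_part ones_d eqxx.
have lt_ones : (index (nseq d 1%N) (partitions d) < nparts d)%N.
  by rewrite index_mem.
pose j := Ordinal lt_ones.
have nth_j : nth [::] (partitions d) j = nseq d 1%N by exact: nth_index.
(* The m-coordinates of h_1^d are row [j] of [h_to_m]; multiplying by the inverse matrix leaves a
   unit vector. *)
have -> : h_coords d (sf_exp (sf_h 1) d : symfun K) = row j 1%:M.
  rewrite /h_coords -(mulmxV (h_to_m_unit K d)) row_mul; congr (_ *m _).
  by apply/rowP => k; rewrite !mxE nth_j sf_exp_hprod.
rewrite (bigD1 j) //= !mxE eqxx mulr1 big1 ?addr0 => [|k /negbTE jk]; last first.
  by rewrite !mxE eq_sym jk mulr0.
by rewrite nth_j coef_m_whittaker // ones_d eqxx mul1r.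
Qed.

(** * Chord diagrams built point by point *)

Section OpenMatchings.
Variable N : nat.
Implicit Types (D : {set {set 'I_N}}) (B C : {set 'I_N}) (i s z : 'I_N).

Definition below n : {set 'I_N} := [set i : 'I_N | (i < n)%N].

(** A partial matching of the first [n] points. The ambient set ['I_N] stays fixed so that [n] can
    vary in inductions without changing types. *)
Definition matching n D :=
  trivIset D && [forall B in D, (B \subset below n) && (#|B| == 2%N)].

Definition open_points n D : {set 'I_N} := below n :\: cover D.

Definition straddles s C :=
  [exists a in C, (a < s)%N] && [exists b in C, (s < b)%N].

(* An open point is joined to a partner at position >= n, so its chord will
   cross every present chord that straddles it. *)
Definition weight n D :=
  (#|crossings D| + \sum_(C in D) #|[set s in open_points n D | straddles s C]|)%N.

Lemma matchingP n D :
  reflect (trivIset D /\ forall B, B \in D -> B \subset below n /\ #|B| = 2%N)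
    (matching n D).
Proof.
apply: (iffP andP) => -[tD hD]; split=> //.
  by move=> B BD; have /implyP/(_ BD)/andP[? /eqP] := forallP hD B.
by apply/forall_inP => B /hD[-> ->].
Qed.

Lemma straddles2 s i z :
  straddles s [set i; z] = ((i < s < z) || (z < s < i))%N.
Proof.
apply/andP/orP => [[/exists_inP[a + ha] /exists_inP[b + hb]]|].
  rewrite !inE => /orP[]/eqP Ea /orP[]/eqP Eb; subst a b.
  - by have := ltn_trans ha hb; rewrite ltnn.
  - by left; rewrite ha.
  - by right; rewrite ha.
  - by have := ltn_trans ha hb; rewrite ltnn.
by case=> /andP[h1 h2]; split; apply/exists_inP; [exists i|exists z|exists z|exists i];
  rewrite ?inE ?eqxx ?orbT.
Qed.

Lemma card2P B : #|B| = 2%N -> exists a b : 'I_N, (a < b)%N /\ B = [set a; b].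
Proof.
move/eqP/cards2P => [a [b [ab ->]]].
have [lt|gt|/val_inj E] := ltngtP a b; last by rewrite E eqxx in ab.
  by exists a, b.
by exists b, a; rewrite setUC.
Qed.

Lemma set2_inj_lt (a b c d : 'I_N) :
  (a < b)%N -> (c < d)%N -> [set a; b] = [set c; d] -> a = c /\ b = d.
Proof.
move=> ab cd E.
have: a \in [set c; d] by rewrite -E !inE eqxx.
have: b \in [set c; d] by rewrite -E !inE eqxx orbT.
rewrite !inE => /orP[]/eqP Eb /orP[]/eqP Ea; subst a b => //.
- by rewrite ltnn in ab.
- by have := ltn_trans ab cd; rewrite ltnn.
- by rewrite ltnn in ab.
Qed.

Lemma crossing2 (a b c d : 'I_N) : (a < b)%N -> (c < d)%N ->
  crossing [set a; b] [set c; d] = ((a < c < b) && (b < d) || (c < a < d) && (d < b))%N.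
Proof.
move=> ab cd; apply/existsP/idP => [[a' /existsP[b' /existsP[c' /existsP[d']]]]|h].
  case/and5P => /eqP E1 /eqP E2 ab' cd'.
  have [-> ->] := set2_inj_lt ab ab' E1.
  have [-> ->] := set2_inj_lt cd cd' E2.
  by rewrite !andbA.
exists a; apply/existsP; exists b; apply/existsP; exists c; apply/existsP; exists d.
by rewrite !eqxx ab cd /= !andbA.
Qed.

Lemma crossing_sizes B C : crossing B C -> exists a b c d : 'I_N,
  [/\ (a < b)%N, (c < d)%N, B = [set a; b] & C = [set c; d]].
Proof.
case/existsP=> a /existsP[b /existsP[c /existsP[d]]].
by case/and5P => /eqP E1 /eqP E2 ab cd _; exists a, b, c, d.
Qed.

Lemma crossing_sym B C : crossing B C = crossing C B.
Proof.
suff h B1 C1 : crossing B1 C1 -> crossing C1 B1 by apply/idP/idP; exact: h.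
move=> cBC; have [a [b [c [d [ab cd EB EC]]]]] := crossing_sizes cBC.
by move: cBC; rewrite EB EC !crossing2 // orbC.
Qed.

Lemma crossing_irr B : crossing B B = false.
Proof.
case cBB: (crossing B B) => //.
have [a [b [_ [_ [ab _ EB _]]]]] := crossing_sizes cBB.
by rewrite -cBB EB crossing2 // !ltnn.
Qed.

(** The end [z] lies to the right of all of [C], so only the position of [i] relative to [C]
    matters. *)
Lemma crossing_top n i z C : (i < z)%N -> z = n :> nat ->
  C \subset below n -> #|C| = 2%N -> crossing [set i; z] C = straddles i C.
Proof.
move=> iz zn Cn /card2P[a [b [ab EC]]]; subst C.
have bz : (b < z)%N.
  by rewrite zn; have /subsetP/(_ b) := Cn; rewrite !inE eqxx orbT => /(_ isT).
rewrite crossing2 // straddles2 [(z < b)%N]ltnNge (ltnW bz) andbF bz andbT orFb.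
have [bi|_] := ltnP b i; last by rewrite orbF.
by rewrite (ltnNge i a) (ltnW (ltn_trans ab bi)) orbF.
Qed.

(** The new crossings are the pairs formed by [B] and a chord of [D]. Such pairs are distinct for
    distinct chords, and none is an old crossing because [B] is not in [D]. *)
Lemma card_crossings_add D B : B \notin D ->
  #|crossings (B |: D)| = (#|crossings D| + #|[set C in D | crossing B C]|)%N.
Proof.
move=> BD; pose f C := [set B; C].
have f_inj : {in [set C in D | crossing B C] &, injective f}.
  move=> C C'; rewrite !inE => /andP[CD _] /andP[CD' _] E.
  have : C \in f C' by rewrite -E !inE eqxx orbT.
  by rewrite !inE => /orP[]/eqP // EC; rewrite -EC CD in BD.
rewrite -(card_in_imset f_inj) -cardsUI [X in (_ + X)%N](_ : _ = 0%N) ?addn0; last first.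
  apply/eqP; rewrite cards_eq0 -subset0; apply/subsetP => E; rewrite !inE.
  case/andP => /imset2P[C1 C2]; rewrite inE => C1D /andP[C2D _] ->.
  case/imsetP => C; rewrite !inE => _ EC.
  have : B \in [set C1; C2] by rewrite EC !inE eqxx.
  by rewrite !inE => /orP[]/eqP EB; rewrite EB ?C1D ?C2D in BD.
apply: eq_card => E; rewrite inE; apply/imset2P/orP => [[C1 C2 h1 h2 ->]|].
  move: h1 h2; rewrite !inE => /orP[/eqP->|C1D] /andP[/orP[/eqP->|C2D] h].
  - by rewrite crossing_irr in h.
  - by right; apply/imsetP; exists C2; rewrite ?inE ?C2D.
  - by right; apply/imsetP; exists C1; rewrite ?inE ?C1D 1?crossing_sym // /f setUC.
  - by left; apply/imset2P; exists C1 C2; rewrite ?inE ?C2D.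
case=> [/imset2P[C1 C2]|/imsetP[C]]; rewrite !inE.
  move=> C1D /andP[C2D h] ->; exists C1 C2 => //; rewrite !inE ?C1D ?C2D ?orbT //.
move=> /andP[CD h] ->; exists B C => //; rewrite !inE ?eqxx ?CD ?orbT //.
Qed.

Lemma notin_cover D C s : s \notin cover D -> C \in D -> s \notin C.
Proof. by move=> sD CD; apply: contra sD => sC; apply/bigcupP; exists C. Qed.

Section AddChord.
Variables (n : nat) (z : 'I_N).
Hypothesis zn : z = n :> nat.

Lemma below_S : below n.+1 = z |: below n.
Proof. by apply/setP => i; rewrite !inE ltnS leq_eqVlt -val_eqE /= zn. Qed.

Lemma z_notin_below : z \notin below n.
Proof. by rewrite inE zn ltnn. Qed.

Lemma z_notin_cover D : matching n D -> z \notin cover D.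
Proof.
case/matchingP=> _ h; apply/bigcupP => -[B BD zB].
by have [/subsetP/(_ _ zB)] := h B BD; rewrite (negbTE z_notin_below).
Qed.

Lemma matching_S D : matching n.+1 D && (z \notin cover D) = matching n D.
Proof.
apply/andP/idP => [[/matchingP[tD h] zD]|mD].
  apply/matchingP; split=> // B BD; have [Bn ->] := h B BD; split=> //.
  apply/subsetP => i iB; have := subsetP Bn i iB; rewrite below_S in_setU1.
  by case: eqP => // E; move: (notin_cover zD BD); rewrite -E iB.
split; last exact: z_notin_cover.
case/matchingP: mD => tD h; apply/matchingP; split=> // B BD; have [Bn ->] := h B BD.
by split=> //; rewrite below_S subsetU // Bn orbT.
Qed.

Lemma open_points_S D : matching n D -> open_points n.+1 D = z |: open_points n D.
Proof.
move=> mD; rewrite /open_points below_S setDUl; congr (_ :|: _).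
by apply/setDidPl; rewrite disjoints1 z_notin_cover.
Qed.

Lemma z_notin_open D : z \notin open_points n D.
Proof. by rewrite inE (negbTE z_notin_below) andbF. Qed.

(** The new open point [z] lies to the right of every chord, so no chord straddles it. *)
Lemma weight_S D : matching n D -> weight n.+1 D = weight n D.
Proof.
move=> mD; rewrite /weight open_points_S //.
congr (_ + _)%N; apply: eq_bigr => C CD; apply: eq_card => s.
rewrite [LHS]in_set [RHS]in_set in_setU1; case: eqP => //= ->.
rewrite (negbTE (z_notin_open D)) /=; apply/negbTE/nandP; right.
case/matchingP: mD => _ /(_ C CD)[/subsetP Cn _].
by apply/exists_inP => -[b /Cn]; rewrite inE zn => /ltnW; rewrite leqNgt => /negP.
Qed.

Section Chord.
Variables (D : {set {set 'I_N}}) (i : 'I_N).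
Hypotheses (mD : matching n D) (iD : i \in open_points n D).
Local Notation B := [set i; z].

Lemma lt_iz : (i < z)%N.
Proof. by move: iD; rewrite !inE zn => /andP[]. Qed.

Lemma chord_notin : B \notin D.
Proof.
apply/negP => BD; case/negP: (z_notin_cover mD); apply/bigcupP; exists B => //.
by rewrite !inE eqxx orbT.
Qed.

Lemma chord_trivIset : trivIset (B |: D).
Proof.
case/matchingP: (mD) => tD hD.
have D0 : set0 \notin D by apply/negP => /hD[_]; rewrite cards0.
suff h : {in D, forall C, [disjoint B & C]} by case: (trivIsetU1 h tD D0).
move=> C CD.
rewrite -setI_eq0 -subset0; apply/subsetP => s; rewrite !inE => /andP[+ sC].
have [iz sD] : i \notin cover D /\ s \in cover D.
  by move: iD; rewrite inE => /andP[-> _]; split=> //; apply/bigcupP; exists C.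
have zD := z_notin_cover mD.
by case/orP=> /eqP E; [rewrite -E sD in iz | rewrite -E sD in zD].
Qed.

Lemma matching_add : matching n.+1 (B |: D).
Proof.
case/matchingP: (mD) => _ hD; apply/matchingP; split; first exact: chord_trivIset.
move=> C; rewrite in_setU1 => /orP[/eqP ->|/hD[Cn ->]]; last first.
  by rewrite below_S subsetU // Cn orbT.
rewrite cards2 neq_ltn lt_iz subUset !sub1set !inE zn ltnS leqnn andbT.
by rewrite -zn ltnW ?lt_iz.
Qed.

Lemma cover_add : cover (B |: D) = B :|: cover D.
Proof. by rewrite /cover big_setU1 // chord_notin. Qed.

Lemma open_points_add : open_points n.+1 (B |: D) = open_points n D :\ i.
Proof.
rewrite /open_points cover_add below_S; apply/setP => s; rewrite !inE.
have [_|_] := eqVneq s i; first by [].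
have [->|_] := eqVneq s z; last by [].
by rewrite zn ltnn andbF.
Qed.

Lemma pblock_add : pblock (B |: D) z = B.
Proof.
by apply: (def_pblock chord_trivIset); rewrite !inE ?eqxx ?orbT.
Qed.

(** Crossings of the new chord with old ones were already counted in advance at the open point [i].
    The increase comes from the open points that the new chord straddles. *)
Lemma weight_add :
  weight n.+1 (B |: D) = (weight n D + #|[set s in open_points n D | (i < s)%N]|)%N.
Proof.
rewrite /weight card_crossings_add ?chord_notin // open_points_add
  big_setU1 ?chord_notin //=.
have -> : [set s in open_points n D :\ i | straddles s B] =
    [set s in open_points n D | (i < s)%N].
  apply/setP => s; rewrite [LHS]inE [RHS]inE in_setD1 straddles2.
  have [->|_] := eqVneq s i; first by rewrite ltnn !andbF.
  rewrite andTb; case: (boolP (s \in open_points n D)) => //=.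
  rewrite 2!inE => /andP[_]; rewrite -zn => sz.
  by rewrite sz andbT [(z < s)%N]ltnNge (ltnW sz) orbF.
have -> : #|[set C in D | crossing B C]| = (\sum_(C in D) straddles i C)%N.
  rewrite -sum1_card big_mkcond [RHS]big_mkcond; apply: eq_bigr => C _; rewrite inE.
  case CD: (C \in D) => //=; have /matchingP[_ /(_ C CD)[Cn C2]] := mD.
  by rewrite (crossing_top lt_iz zn Cn C2); case: straddles.
rewrite -!addnA; congr (_ + _)%N; rewrite addnCA addnC -big_split /=; congr (_ + _)%N.
(* For each old chord, the term of [i] among the open points it straddles is what became an actual
   crossing. *)
apply: eq_bigr => C CD; rewrite [in RHS](cardsD1 i) inE iD /=; congr (_ + _)%N.
by apply: eq_card => s; rewrite !inE -!andbA.
Qed.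

End Chord.

Section Last.
Variable D : {set {set 'I_N}}.
Hypotheses (mD : matching n.+1 D) (zD : z \in cover D).
Local Notation B := (pblock D z).

Lemma last_chord : exists2 i, i != z & B = [set i; z].
Proof.
have [_ hD] := matchingP _ _ mD.
have [_ /eqP/cards2P[a [b [ab EB]]]] := hD _ (pblock_mem zD).
have : z \in B by rewrite mem_pblock.
rewrite EB !inE => /orP[]/eqP E; subst z; last by exists a.
by exists b; rewrite 1?eq_sym // setUC.
Qed.

Lemma matching_last : matching n (D :\ B).
Proof.
have [tD hD] := matchingP _ _ mD; rewrite -matching_S; apply/andP; split.
  apply/matchingP; split; first by apply: trivIsetS tD; exact: subsetDl.
  by move=> C /setD1P[_]; exact: hD.
apply/bigcupP => -[C /setD1P[CB CD] zC]; case/eqP: CB.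
by rewrite (def_pblock tD CD zC).
Qed.

Lemma open_last i : B = [set i; z] -> i != z -> i \in open_points n (D :\ B).
Proof.
move=> EB iz; have [tD hD] := matchingP _ _ mD.
have iB : i \in B by rewrite EB !inE eqxx.
have [/subsetP/(_ i iB) + _] := hD _ (pblock_mem zD).
rewrite below_S in_setU1 (negbTE iz) /= => i_n; rewrite inE i_n andbT.
apply/bigcupP => -[C /setD1P[CB CD] iC]; case/eqP: CB.
by rewrite -(def_pblock tD CD iC) (def_pblock tD (pblock_mem zD) iB).
Qed.

End Last.

(** The inverse of adding a chord that ends at [z]: the remaining chords and the partner of [z]. The
    default [z] covers the case where [z] has no partner. *)
Definition detach D :=
  (D :\ pblock D z, odflt z [pick i in pblock D z :\ z]).

Lemma detachE D i : i != z -> pblock D z = [set i; z] ->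
  detach D = (D :\ [set i; z], i).
Proof.
move=> iz E; rewrite /detach E; congr pair; case: pickP => [j|/(_ i)] /=.
  by rewrite !inE => /andP[/negbTE ->]; rewrite orbF => /eqP.
by rewrite !inE eqxx iz.
Qed.

End AddChord.

(** * Generating functions of matchings with open points *)

Section WeightSum.
Variables (R : comNzRingType) (x : R).

Definition matching_gf (n k : nat) : R :=
  \sum_(D | matching n D && (#|open_points n D| == k)) x ^+ weight n D.

(** Induction on the size of [A]: the smallest element has all the others to its right and gives the
    top power, and removing it does not change the counts of the others. *)
Lemma sum_rank (A : {set 'I_N}) :
  \sum_(i in A) x ^+ #|[set s in A | (i < s)%N]| = \sum_(j < #|A|) x ^+ j.
Proof.
move E: #|A| => k; elim: k A E => [|k IH] A E.
  by rewrite big_ord0 (cards0_eq E) big_set0.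
have [a0 a0A] : exists a, a \in A by apply/card_gt0P; rewrite E.
case: (arg_minnP (fun a : 'I_N => val a) a0A) => a aA' a_min; have aA : a \in A by [].
have cA : #|A :\ a| = k by move: E; rewrite (cardsD1 a) aA => -[].
rewrite (bigD1 a) //= big_ord_recr addrC /= -(IH _ cA); congr (_ + _ ^+ _).
  rewrite (eq_bigl (mem (A :\ a))) => [|i]; last by rewrite !inE andbC.
  apply: eq_bigr => i /setD1P[ia iA]; congr (_ ^+ _); apply: eq_card => s.
  rewrite !inE; have [->|//] := eqVneq s a.
  by rewrite ltnNge (a_min i iA) andbF.
rewrite -cA; apply: eq_card => s; rewrite !inE andbC.
case: (boolP (s \in A)) => [sA|_]; last by rewrite !andbF.
by rewrite !andbT ltn_neqAle (a_min s sA) andbT eq_sym.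
Qed.

Lemma matching_gf0 k : matching_gf 0 k = (k == 0%N)%:R.
Proof.
have b0 : below 0 = set0 by apply/setP => i; rewrite !inE.
have m0 D : matching 0 D = (D == set0).
  apply/matchingP/eqP => [[_ h]|->].
    apply/setP => B; rewrite inE; apply/negP => /h[]; rewrite b0 subset0 => /eqP ->.
    by rewrite cards0.
  by split=> [|B]; rewrite ?inE //; apply/trivIsetP => A B; rewrite inE.
rewrite /matching_gf (eq_bigl (fun D => (D == set0) && (k == 0%N))) => [|D]; last first.
  by rewrite m0; case: eqP => //= ->; rewrite /open_points b0 set0D cards0 eq_sym.
case: eqP => _; last by rewrite big1 // => D; rewrite andbF.
rewrite (eq_bigl (pred1 set0)) => [|D]; last by rewrite andbT.
rewrite big_pred1_eq /weight big_set0 addn0.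
rewrite (_ : crossings set0 = set0) ?cards0 //.
by apply/eqP; rewrite -subset0; apply/subsetP => E /imset2P[B C]; rewrite in_set0.
Qed.

(** The matchings are split according to whether the new point [z] is open or closes a chord. *)
Lemma matching_gfS n k : (n < N)%N ->
  matching_gf n.+1 k = (if k is k'.+1 then matching_gf n k' else 0)
    + (\sum_(j < k.+1) x ^+ j) * matching_gf n k.+1.
Proof.
move=> nN; pose z := Ordinal nN; have zn : z = n :> nat by [].
rewrite [LHS](bigID (fun D => z \notin cover D)) /=; congr (_ + _).
  rewrite (eq_bigl (fun D => matching n D && (#|open_points n D|.+1 == k))).
    case: k => [|k]; first by rewrite big1 // => D /andP[].
    by apply: eq_bigr => D /andP[/(weight_S zn) -> _].
  move=> D; rewrite andbAC (matching_S zn); case mD: (matching n D) => //=.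
  by rewrite (open_points_S zn mD) cardsU1 (z_notin_open zn).
under eq_bigl do rewrite negbK.
(* [sum_rank] turns the [q]-integer into a sum over the open points [i] to which [z] can be
   joined. *)
rewrite mulr_sumr; under [RHS]eq_bigr => D /andP[_ /eqP cD].
  rewrite -cD -sum_rank mulr_suml; over.
rewrite pair_big_dep /=.
(* A matching covering [z] corresponds to a pair of a matching of the first [n] points and one of
   its open points. *)
rewrite (reindex_onto (fun p : _ * 'I_N => [set p.2; z] |: p.1) (detach z)); last first.
  move=> D /andP[/andP[mD _] zD]; have [i iz EB] := last_chord zn mD zD.
  by rewrite (detachE iz EB) /= -EB setD1K // pblock_mem.
apply: eq_big => [[D i]|[D i]] /=; last first.
  case/andP=> /andP[/andP[mD _] zD] /eqP E.
  have [j jz EB] := last_chord zn mD zD.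
  have := matching_last zn mD; have := open_last zn mD zD EB jz.
  move: E; rewrite (detachE jz EB) EB => -[ED Ej]; rewrite ED Ej => iD m0D.
  by rewrite (weight_add zn m0D iD) addnC exprD.
apply/idP/idP.
  case/andP=> /andP[/andP[mD oD] zD] /eqP E.
  have [j jz EB] := last_chord zn mD zD.
  have := matching_last zn mD; have := open_last zn mD zD EB jz.
  move: E; rewrite (detachE jz EB) EB => -[ED Ej]; rewrite ED Ej => iD m0D.
  rewrite m0D iD andbT /= (cardsD1 i) iD -(open_points_add zn i m0D).
  by rewrite add1n eqSS.
case/andP=> /andP[mD oD] iD; have iz := lt_iz zn iD.
rewrite (matching_add zn mD iD) (cover_add zn i mD) !inE eqxx orbT andbT.
rewrite (open_points_add zn i mD).
have -> : #|open_points n D :\ i| == k by move: oD; rewrite (cardsD1 i) iD add1n eqSS.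
rewrite (detachE _ (pblock_add zn mD iD)) ?setU1K ?(chord_notin zn i mD) ?eqxx //.
by rewrite neq_ltn iz.
Qed.

Lemma matching_gf_chord_diagram :
  matching_gf N 0 = \sum_(D : {set {set 'I_N}} | chord_diagram D) x ^+ #|crossings D|.
Proof.
have bN : below N = setT by apply/setP => i; rewrite !inE ltn_ord.
apply: eq_big => D; last first.
  case/andP=> _; rewrite cards_eq0 => /eqP o0; rewrite /weight o0 big1 ?addn0 // => C _.
  by apply/eqP; rewrite cards_eq0 -subset0; apply/subsetP => s; rewrite !inE.
rewrite /chord_diagram /matching /partition /open_points bN setTD cards_eq0.
rewrite -(inj_eq (@setC_inj _)) setCK setC0.
have -> : [forall B in D, (B \subset setT) && (#|B| == 2)] = [forall B in D, #|B| == 2].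
  by apply: eq_forallb => B; rewrite subsetT.
case: (boolP [forall B in D, _]) => [/forall_inP h|_]; rewrite ?andbF // !andbT.
(* Blocks of size 2 are nonempty, which supplies the remaining condition of [partition]. *)
rewrite andbC; case: eqP => //= _; case: trivIset => //=; apply/esym/negP => /h.
by rewrite cards0.
Qed.

End WeightSum.
End OpenMatchings.

(** * The polynomial T_m as a sum over chord diagrams *)

Lemma chord_diagram_card m (D : {set {set 'I_(2 * m)}}) : chord_diagram D -> #|D| = m.
Proof.
case/andP=> /card_partition + /forall_inP h; rewrite cardsT card_ord.
rewrite (eq_bigr (fun=> 2%N)) => [|B /h/eqP //].
rewrite sum_nat_const => E; apply/eqP.
by rewrite -(eqn_pmul2r (isT : 0 < 2)%N) -E mulnC.
Qed.

(** No chord crosses itself, so crossings are 2-subsets of [D]. This justifies the range of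
    summation in [T]. *)
Lemma card_crossings_le n (D : {set {set 'I_n}}) : (#|crossings D| <= 'C(#|D|, 2))%N.
Proof.
rewrite -cards_draws; apply/subset_leq_card/subsetP => E /imset2P[B C].
rewrite inE => BD /andP[CD cBC] ->; rewrite inE subUset !sub1set BD CD /= cards2.
by have [BC|] := eqVneq B C; first by rewrite BC crossing_irr in cBC.
Qed.

Lemma T_crossings m :
  T m = \sum_(D : {set {set 'I_(2 * m)}} | chord_diagram D) 'X ^+ #|crossings D|.
Proof.
rewrite (partition_big (fun D => inord #|crossings D| : 'I_('C(m, 2)).+1) xpredT) //=.
apply: eq_bigr => k _; rewrite scaler_nat /chord_count -sumr_const.
apply: eq_big => [D|D]; rewrite inE.
  case: (boolP (chord_diagram D)) => //= /chord_diagram_card cD.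
  have := card_crossings_le D; rewrite cD => le_m.
  by rewrite -val_eqE /= inordK.
by case/andP=> _ /eqP ->.
Qed.

(** * Chains of strips in two-row shapes *)

Section WalkSum.
Variables (R : comNzRingType) (S : finType) (s0 : S) (w : nat -> S -> S -> R).

(** The transfer-matrix recursion for weighted walks of [n] steps from [s0] to [s], with step
    weights depending on the time [j]. *)
Fixpoint walk_sum n s : R :=
  if n is n'.+1 then \sum_r walk_sum n' r * w n' r s else (s == s0)%:R.

Lemma walk_sumE n s :
  \sum_(c : {ffun 'I_n.+1 -> S} | (c ord0 == s0) && (c ord_max == s))
    \prod_(j < n) w j (c (inord j)) (c (inord j.+1)) = walk_sum n s.
Proof.
elim: n s => [|n IH] s /=.
  under eq_bigr do rewrite big_ord0.
  have om : ord_max = ord0 :> 'I_1 by apply: val_inj.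
  case: eqP => [->|s_s0]; last first.
    by rewrite big1 // => c; rewrite om => /andP[/eqP-> /eqP E]; case: s_s0.
  rewrite (big_pred1 [ffun=> s0]) // => c; rewrite om andbb.
  apply/eqP/eqP => [E|->]; last by rewrite ffunE.
  by apply/ffunP => i; rewrite ffunE ord1.
(* Walks of [n.+1] steps ending at [s] correspond to walks of [n] steps with arbitrary end, by
   appending or dropping the last vertex. *)
pose ext (c : {ffun 'I_n.+1 -> S}) : {ffun 'I_n.+2 -> S} :=
  [ffun i : 'I_n.+2 => if (i < n.+1)%N then c (inord i) else s].
pose restr (c : {ffun 'I_n.+2 -> S}) : {ffun 'I_n.+1 -> S} :=
  [ffun i : 'I_n.+1 => c (inord i)].
have extE c j : (j < n.+1)%N -> ext c (inord j) = c (inord j).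
  by move=> lt_j; rewrite ffunE inordK ?lt_j // ltnW.
have ext_max c : ext c ord_max = s by rewrite ffunE /= ltnn.
have ext_last c : ext c (inord n.+1) = s by rewrite ffunE inordK ?ltnn.
have extK c : restr (ext c) = c.
  by apply/ffunP => i; rewrite ffunE extE ?ltn_ord // inord_val.
rewrite (reindex_onto ext restr) /=; last first.
  move=> c /andP[_ /eqP c_max]; apply/ffunP => i; rewrite ffunE ffunE.
  case: ltnP => [lt_i|le_i]; first by rewrite inordK // inord_val.
  rewrite -c_max; congr (c _); apply: val_inj => /=; apply/eqP.
  by rewrite eqn_leq le_i -ltnS ltn_ord.
rewrite (eq_bigl (fun c : {ffun 'I_n.+1 -> S} => c ord0 == s0)) => [|c]; last first.
  rewrite extK eqxx andbT ext_max eqxx andbT ffunE /=.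
  by congr (c _ == _); apply: val_inj; rewrite /= inordK.
(* Grouping by the vertex before last matches the sum over [r] in the recursion. *)
rewrite (partition_big (fun c : {ffun 'I_n.+1 -> S} => c ord_max) xpredT) //=.
apply: eq_bigr => r _; rewrite -IH mulr_suml; apply: eq_bigr => c /andP[_ /eqP c_max].
rewrite big_ord_recr /= ext_last extE // [inord n](_ : _ = ord_max); last first.
  by apply: val_inj; rewrite /= inordK.
rewrite c_max; congr (_ * _); apply: eq_bigr => j _.
by have lt_j := ltn_ord j; rewrite !extE // ltnS ltnW.
Qed.

End WalkSum.

Lemma mem_partitions_le d la : (la \in partitions_le d) = is_part la && (sumn la <= d)%N.
Proof.
apply/flatten_mapP/andP => [[e]|[la_part la_d]].
  by rewrite mem_iota mem_partitions => /andP[_ ed] /andP[-> /eqP->].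
by exists (sumn la); rewrite ?mem_iota ?mem_partitions ?la_part ?eqxx.
Qed.

(** Forbidden steps get weight 0, which moves the chain condition into the weights and lets the sum
    range over all walks. *)
Definition strip_weight (nu : seq nat) j (rho la : seq nat) : K :=
  if horizontal_strip la rho && (sumn la == sumn rho + nth 0 nu j)%N
  then psi la rho else 0.

Lemma whittaker_coefE mu nu (s0 s1 : seq_sub (partitions_le (sumn mu))) :
    val s0 = [::] -> val s1 = mu ->
  whittaker_coef mu nu =
  walk_sum s0 (fun j r s => strip_weight nu j (val r) (val s)) (size nu) s1.
Proof.
move=> s0E s1E; rewrite -walk_sumE /whittaker_coef big_mkcond [RHS]big_mkcond.
apply: eq_bigr => c _; rewrite /strip_chain.
have -> : (val (c ord0) == [::]) = (c ord0 == s0) by rewrite -s0E val_eqE.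
have -> : (val (c ord_max) == mu) = (c ord_max == s1)
  by rewrite -[X in _ == X]s1E val_eqE.
case: (c ord0 == s0) => //=; case: (c ord_max == s1) => //=.
case: ifPn => [/forallP h|/forallPn[j nj]].
  by apply: eq_bigr => j _; rewrite /strip_weight h.
by rewrite (bigD1 j) //= /strip_weight (negbTE nj) mul0r.
Qed.

(** * q-integers and strips between two-row shapes *)

Lemma qint_neq0 n : (0 < n)%N -> qint n != 0.
Proof.
case: n => // n _.
have -> : qint n.+1 = FracField.tofrac (\poly_(i < n.+1) (1 : rat)).
  rewrite poly_def rmorph_sum; apply: eq_bigr => i _.
  by rewrite scale1r rmorphXn.
rewrite tofrac_eq0; apply/eqP => /polyP/(_ 0%N)/eqP.
by rewrite coef_poly coef0 oner_eq0.
Qed.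

Lemma qfact0 : qfact 0 = 1.
Proof. by rewrite /qfact big_nil. Qed.

Lemma qfactS n : qfact n.+1 = qfact n * qint n.+1.
Proof. by rewrite /qfact big_nat_recr. Qed.

Lemma qfact_neq0 n : qfact n != 0.
Proof.
elim: n => [|n IH]; first by rewrite qfact0; exact: oner_neq0.
by rewrite qfactS; apply: mulf_neq0; [exact: IH | exact: qint_neq0].
Qed.

Lemma qbinom0 n : qbinom n 0 = 1.
Proof. by rewrite /qbinom /= subn0 qfact0 mul1r divff ?qfact_neq0. Qed.

Lemma qbinom1 n : (0 < n)%N -> qbinom n 1 = qint n.
Proof.
case: n => // n _; rewrite /qbinom /= subn1 /= !qfactS qfact0.
have -> : qint 1 = 1 by rewrite /qint big_ord1.
by rewrite !mul1r mulrAC divff ?mul1r ?qfact_neq0.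
Qed.

(* The filter removes zero parts, so that b = 0 or a = b = 0 is allowed. *)
Definition two_rows (a b : nat) : seq nat := [seq i <- [:: a; b] | i != 0%N].

Section TwoRows.
Variables a b : nat.
Hypothesis ba : (b <= a)%N.

Lemma nth_two_rows i : nth 0%N (two_rows a b) i = nth 0%N [:: a; b] i.
Proof.
rewrite /two_rows /=; case: (posnP a) ba => [-> |a0 _].
  by rewrite leqn0 => /eqP ->; case: i => [|[|i]] //=; rewrite !nth_nil.
rewrite /=; case: (posnP b) => [->|b0]; last by [].
by case: i => [|[|i]] //=; rewrite !nth_nil.
Qed.

Lemma sumn_two_rows : sumn (two_rows a b) = (a + b)%N.
Proof.
by rewrite /two_rows /=; case: eqP => [->|]; case: eqP => [->|] /=; rewrite ?addn0.
Qed.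

Lemma two_rows_part : is_part (two_rows a b).
Proof.
apply/andP; split; last by rewrite mem_filter.
apply: sorted_filter; first by move=> x y z yx xz; exact: leq_trans xz yx.
by rewrite /= andbT.
Qed.

Lemma psi_two_rows rho :
  psi (two_rows a b) rho =
  qbinom (a - b) (a - nth 0 rho 0) * qbinom b (b - nth 0 rho 1).
Proof.
rewrite /psi; under eq_bigr do rewrite !nth_two_rows.
rewrite /two_rows /=; case: (posnP a) ba => [-> |a0 _].
  by rewrite leqn0 => /eqP -> /=; rewrite big_ord0 !sub0n !qbinom0 mulr1.
rewrite /=; case: (posnP b) => [->|b0] /=.
  by rewrite big_ord1 /= sub0n qbinom0 mulr1.
by rewrite big_ord_recl big_ord1 /= subn0.
Qed.

End TwoRows.

Lemma part_two_rows la : is_part la -> nth 0%N la 2 = 0%N ->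
  (nth 0%N la 1 <= nth 0%N la 0)%N /\ la = two_rows (nth 0%N la 0) (nth 0%N la 1).
Proof.
rewrite /is_part /two_rows; case: la => [|x [|y [|z la]]] //=; rewrite !inE.
- by rewrite eq_sym => ->.
- rewrite negb_or ![0%N == _]eq_sym => /andP[/andP[yx _] /andP[-> ->]].
  by rewrite yx.
- by move=> + z0; rewrite z0 eqxx !orbT andbF.
Qed.

(** Removing one box from a two-row shape leaves a partition in at most two ways, and a single box
    is always a horizontal strip. *)
Lemma strip_two_rows a b rho : (b <= a)%N -> is_part rho ->
  horizontal_strip (two_rows a b) rho && (sumn (two_rows a b) == sumn rho + 1)%N =
  ((b < a)%N && (rho == two_rows a.-1 b)) || ((0 < b)%N && (rho == two_rows a b.-1)).
Proof.
move=> ba rho_part; rewrite sumn_two_rows //; apply/andP/idP.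
  case=> /andP[/forallP le_nth _] /eqP sum_rho.
  have {}le_nth i : (nth 0%N rho i <= nth 0%N (two_rows a b) i)%N.
    case: (ltnP i (maxn (size (two_rows a b)) (size rho))) => [lt_i|].
      exact: (le_nth (Ordinal lt_i)).
    by rewrite geq_max => /andP[_ le_i]; rewrite nth_default.
  have := le_nth 0%N; have := le_nth 1%N; have := le_nth 2%N.
  rewrite !nth_two_rows //= leqn0 => /eqP rho2.
  have [r10 rhoE] := part_two_rows rho_part rho2.
  move: sum_rho; rewrite {1}rhoE sumn_two_rows //.
  move: r10 rhoE; move: (nth _ _ 0) (nth _ _ 1) => c d dc -> sum_cd db ca.
  have [ac|ac] := eqVneq a c; apply/orP; [right|left]; apply/andP; split.
  - lia.
  - by apply/eqP; congr two_rows; lia.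
  - lia.
  - by apply/eqP; congr two_rows; lia.
move=> h; have [c [d [dc cd ca db ->]]] : exists c d, [/\ (d <= c)%N,
    (a + b = c + d + 1)%N, (c <= a)%N, (d <= b)%N & rho = two_rows c d].
  case/orP: h => /andP[h /eqP ->].
    by exists a.-1, b; split=> //; lia.
  by exists a, b.-1; split=> //; lia.
rewrite sumn_two_rows // cd eqxx; split=> //; apply/andP; split.
  by apply/forallP => i; rewrite !nth_two_rows //; case: (val i) => [|[|j]].
apply/forallP => j; apply/card_le1_eqP => i i'.
have lt2 (k : 'I_(size (two_rows a b))) : (k < 2)%N.
  apply: leq_trans (ltn_ord k) _; rewrite size_filter; exact: count_size.
rewrite !inE !nth_two_rows // => hi hi'; apply: val_inj.
move: hi hi' (lt2 i) (lt2 i') => /=.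
by move: (nat_of_ord i) (nat_of_ord i') => [|[|k]] [|[|k']] //=; lia.
Qed.

Lemma strip_weight_two_rows j n a b rho : (j < n)%N -> (b <= a)%N -> is_part rho ->
  strip_weight (nseq n 1%N) j rho (two_rows a b) =
    (if (b < a)%N && (rho == two_rows a.-1 b) then qint (a - b) else 0)
  + (if (0 < b)%N && (rho == two_rows a b.-1) then qint b else 0).
Proof.
move=> jn ba rho_part; rewrite /strip_weight nth_nseq jn strip_two_rows //
  psi_two_rows //.
case: (boolP (_ && (rho == two_rows a.-1 b))) => [/andP[lt_ba /eqP ->]|_] /=.
  have ba' : (b <= a.-1)%N by lia.
  rewrite !nth_two_rows //= subnn qbinom0 mulr1.
  rewrite (_ : (a - a.-1 = 1)%N); last by lia.
  rewrite qbinom1; last by lia.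
  (* The two predecessors differ in their first row, so the second term vanishes here. *)
  case: ifP => [/andP[b0 /eqP E]|]; last by rewrite addr0.
  have := nth_two_rows ba' 0; rewrite E nth_two_rows /=; lia.
case: ifP => [/andP[b0 /eqP ->]|_]; last by rewrite addr0.
rewrite !nth_two_rows /=; [|lia|lia].
rewrite subnn qbinom0 mul1r add0r (_ : (b - b.-1 = 1)%N); last by lia.
by rewrite qbinom1.
Qed.

(** * Comparison of walks on two-row shapes with matchings *)

Lemma sum_seq_sub_pred1 (R : nmodType) (T : choiceType) (s : seq T) (y : T) (c : R) :
  y \in s -> \sum_(r : seq_sub s) (if val r == y then c else 0) = c.
Proof.
by move=> ys; rewrite -big_mkcond (big_pred1 (SeqSub ys)).
Qed.

Lemma matching_gf_gt N (R : comNzRingType) (x : R) n k :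
  (n <= N)%N -> (n < k)%N -> matching_gf N x n k = 0.
Proof.
elim: n k => [|n IH] k nN; first by rewrite matching_gf0; case: k.
case: k => // k nk; rewrite matching_gfS // !IH ?mulr0 ?addr0 //; lia.
Qed.

(** Induction on [n]: with k = a - b, the predecessors (a-1, b) and (a, b-1) correspond to the two
    terms of [matching_gfS], and the weights of the steps complete the [q]-factorials. *)
Lemma walk_sum_two_rows N d (s0 : seq_sub (partitions_le d)) n a b s :
    val s0 = [::] -> (d <= N)%N -> (b <= a)%N -> (a + b = n)%N -> val s = two_rows a b ->
  walk_sum s0 (fun j r s => strip_weight (nseq d 1%N) j (val r) (val s)) n s =
  qfact b * qfact (a - b) * matching_gf N q n (a - b).
Proof.
move=> s0E dN; elim: n a b s => [|n IH] a b s ba ab_n sE.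
  have [a0 b0] : a = 0%N /\ b = 0%N by lia.
  subst a b => /=; rewrite matching_gf0 qfact0 !mulr1 -val_eqE s0E sE.
  by [].
(* The end [s] has size [n.+1] at most [d], so the strip of step [n] has size 1 and not the default
   0 of [nth]. *)
have nd : (n < d)%N.
  have := valP s; rewrite mem_partitions_le => /andP[_].
  by rewrite /= [ssval s]sE sumn_two_rows // ab_n.
rewrite [LHS]/=.
pose t1 := qint (a - b) * (qfact b * qfact (a.-1 - b) * matching_gf N q n (a.-1 - b)).
pose t2 := qint b * (qfact b.-1 * qfact (a - b.-1) * matching_gf N q n (a - b.-1)).
transitivity (\sum_(r : seq_sub (partitions_le d))
  ((if val r == two_rows a.-1 b then (if (b < a)%N then t1 else 0) else 0)
   + (if val r == two_rows a b.-1 then (if (0 < b)%N then t2 else 0) else 0))).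
  apply: eq_bigr => r _.
  have r_part : is_part (val r).
    by have := valP r; rewrite mem_partitions_le => /andP[].
  rewrite [ssval s]sE (strip_weight_two_rows nd ba r_part) mulrDr.
  congr (_ + _).
    case: ifP => [/andP[lt_ba /eqP rE]|].
      rewrite rE eqxx lt_ba (IH _ _ _ _ _ rE) 1?mulrC //; lia.
    rewrite mulr0; by case: (b < a)%N => /= [->|]; rewrite ?if_same.
  case: ifP => [/andP[lt_ba /eqP rE]|].
    rewrite rE eqxx lt_ba (IH _ _ _ _ _ rE) 1?mulrC //; lia.
  rewrite mulr0; by case: (0 < b)%N => /= [->|]; rewrite ?if_same.
have mem_t c e : (e <= c)%N -> (c + e <= d)%N -> two_rows c e \in partitions_le d.
  by move=> ec cd; rewrite mem_partitions_le two_rows_part // sumn_two_rows.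
have sum1 : \sum_(r : seq_sub (partitions_le d))
    (if val r == two_rows a.-1 b then (if (b < a)%N then t1 else 0) else 0) =
    if (b < a)%N then t1 else 0.
  case: (ltnP b a) => lt_ba; last by rewrite big1 // => r _; rewrite if_same.
  by apply: sum_seq_sub_pred1; apply: mem_t; lia.
have sum2 : \sum_(r : seq_sub (partitions_le d))
    (if val r == two_rows a b.-1 then (if (0 < b)%N then t2 else 0) else 0) =
    if (0 < b)%N then t2 else 0.
  case: (ltnP 0 b) => lt_b; last by rewrite big1 // => r _; rewrite if_same.
  by apply: sum_seq_sub_pred1; apply: mem_t; lia.
rewrite big_split /= sum1 sum2 matching_gfS; last by lia.
rewrite mulrDr; congr (_ + _).
  case: ltnP => lt_ba; last first.
    have -> : (a - b = 0)%N by lia.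
    by rewrite mulr0.
  rewrite /t1 (_ : (a - b = (a.-1 - b).+1)%N); last by lia.
  by rewrite qfactS mulrA; congr (_ * _); rewrite mulrC mulrA.
case: (posnP b) => [b0|b_gt0].
  (* For [b = 0] there is no second predecessor, and the other side vanishes because [n] points
     cannot leave [n.+2] of them open. *)
  by rewrite matching_gf_gt ?mulr0 //; lia.
have bE : qfact b = qfact b.-1 * qint b by rewrite -{1}(prednK b_gt0) qfactS prednK.
rewrite /t2 (_ : (a - b.-1 = (a - b).+1)%N); last by lia.
by rewrite bE qfactS -/(qint (a - b).+1) -!mulrA mulrCA.
Qed.

Theorem theorem5p6 (m : nat) (hm : (0 < m)%N) :
  FracField.tofrac (T m) = (qfact m)^-1 * hall (whittaker [:: m; m]) (sf_exp (sf_h 1) (2 * m)).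
Proof.
have mu_part : is_part [:: m; m] by rewrite /is_part /= !inE leqnn; lia.
have mu_sum : (2 * m = sumn [:: m; m])%N by rewrite /=; lia.
rewrite [in RHS]mu_sum hall_whittaker_h1 //; set d := sumn _ in mu_sum *.
have mem0 : [::] \in partitions_le d by rewrite mem_partitions_le.
have mem_mu : [:: m; m] \in partitions_le d by rewrite mem_partitions_le mu_part leqnn.
rewrite (@whittaker_coefE _ _ (SeqSub mem0) (SeqSub mem_mu)) // size_nseq.
have le_d : (d <= 2 * m)%N by rewrite mu_sum.
have mm_d : (m + m = d)%N by rewrite /d /= addn0.
have muE : [:: m; m] = two_rows m m by rewrite /two_rows /= -lt0n hm.
rewrite (@walk_sum_two_rows (2 * m) _ (SeqSub mem0) _ m m (SeqSub mem_mu)) //.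
(* At a = b = m the prefactor is [m]! [0]!, and no open point remains, so the generating function
   counts complete diagrams. *)
rewrite subnn qfact0 mulr1 mulKf ?qfact_neq0 // -mu_sum matching_gf_chord_diagram.
rewrite T_crossings rmorph_sum; apply: eq_bigr => D _; exact: tofracXn.
Qed.
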